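(* Consider the two-stage linear adaptive robust optimization problem (P) and the constraint-and-column generation procedure described in the context, in which all subproblems are solved to optimality. If the procedure terminates, the solution $\bm{x}^{\mathrm{PARO}}$ it returns is Pareto Adaptive Robustly Optimal (PARO) to (P).
   Context: Problem (P): $\min_{\bm{x},\bm{y}(\cdot)}\max_{\bm{z}\in U}\ \bm{c}(\bm{z})^{\top}\bm{x}+\bm{d}^{\top}\bm{y}(\bm{z})$ subject to $\bm{A}(\bm{z})\bm{x}+\bm{B}\bm{y}(\bm{z})\le \bm{r}(\bm{z})$ for all $\bm{z}\in U$. Here $U\subseteq\mathbb{R}^L$ is compact and convex with nonempty relative interior; $\bm{x}\in\mathbb{R}^{n_x}$ (Stage-1 decision); $\bm{y}\in\mathcal{R}^{L,n_y}$ (Stage-2 decision rule), where $\mathcal{R}^{L,n_y}$ is the set of measurable functions $\mathbb{R}^L\to\mathbb{R}^{n_y}$ that are bounded on compact sets; $\bm{B}\in\mathbb{R}^{m\times n_y}$ and $\bm{d}\in\mathbb{R}^{n_y}$ are constant; $\bm{A}(\bm{z})\in\mathbb{R}^{m\times n_x}$, $\bm{r}(\bm{z})\in\mathbb{R}^m$, $\bm{c}(\bm{z})\in\mathbb{R}^{n_x}$ depend affinely on $\bm{z}$. A pair $(\bm{x},\bm{y}(\cdot))$ is adaptive robustly feasible (ARF) if it satisfies all constraints of (P); $\bm{x}$ is ARF if some $\bm{y}(\cdot)\in\mathcal{R}^{L,n_y}$ makes $(\bm{x},\bm{y}(\cdot))$ ARF, and $\mathcal{X}$ is the set of ARF $\bm{x}$.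 $\mathrm{OPT}$ is the optimal (worst-case) value of (P). Standing assumptions: $\mathcal{X}\ne\emptyset$ and $\mathrm{OPT}$ is finite. A pair is adaptive robustly optimal (ARO) if it is ARF and $\bm{c}(\bm{z})^{\top}\bm{x}+\bm{d}^{\top}\bm{y}(\bm{z})\le\mathrm{OPT}$ for all $\bm{z}\in U$; $\bm{x}$ is ARO if some $\bm{y}(\cdot)$ makes the pair ARO. A pair $(\bm{x},\bm{y}(\cdot))$ is PARO if it is ARO and there is no ARO pair $(\bar{\bm{x}},\bar{\bm{y}}(\cdot))$ with $\bm{c}(\bm{z})^{\top}\bar{\bm{x}}+\bm{d}^{\top}\bar{\bm{y}}(\bm{z})\le \bm{c}(\bm{z})^{\top}\bm{x}+\bm{d}^{\top}\bm{y}(\bm{z})$ for all $\bm{z}\in U$ and with strict inequality for some $\bar{\bm{z}}\in U$. A Stage-1 decision $\bm{x}$ is PARO if there exists $\bm{y}(\cdot)$ such that $(\bm{x},\bm{y}(\cdot))$ is PARO. Subproblem $Q(\bm{x})$: $q(\bm{x})=\max_{\bm{z}\in U}\ \bm{c}(\bm{z})^{\top}\bm{x}+\min_{\bm{y}}\{\bm{d}^{\top}\bm{y}: \bm{A}(\bm{z})\bm{x}+\bm{B}\bm{y}\le\bm{r}(\bm{z})\}$, with $q(\bm{x})=+\infty$ if the inner problem is infeasible for some $\bm{z}\in U$ (such a $\bm{z}$ is then returned as the optimizer). Procedure. Initialization: a first phase provides an ARO Stage-1 solution $\bm{x}^{\mathrm{ARO}}$, a finite set $M^{\mathrm{ARO}}\subseteq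 U$ and the value $\mathrm{OPT}$. Set $k=0$, $\bm{x}^0=\bm{x}^{\mathrm{ARO}}$, $M^0=M^{\mathrm{ARO}}$. For $\bm{z}^l\in M^k$ define $v(\bm{x}^k,\bm{z}^l)=\mathrm{OPT}$ if $\bm{z}^l\in M^{\mathrm{ARO}}$, and $v(\bm{x}^k,\bm{z}^l)=\bm{c}(\bm{z}^l)^{\top}\bm{x}^k+\min_{\bm{y}}\{\bm{d}^{\top}\bm{y}:\bm{A}(\bm{z}^l)\bm{x}^k+\bm{B}\bm{y}\le\bm{r}(\bm{z}^l)\}$ if $\bm{z}^l\in M^k\setminus M^{\mathrm{ARO}}$. Iteration $k$: solve problem $P_2(\bm{x}^k,M^k)$, whose optimal value is denoted $p_2^k$: $$\min_{\bm{z}^c,\bm{x}^c,\bm{y}^c,\{\bm{y}^l\}_{l=1}^{|M^k|}}\ \ \max_{\bm{y}^k:\ \bm{A}(\bm{z}^c)\bm{x}^k+\bm{B}\bm{y}^k\le\bm{r}(\bm{z}^c)}\ \big(\bm{c}(\bm{z}^c)^{\top}\bm{x}^c+\bm{d}^{\top}\bm{y}^c\big)-\big(\bm{c}(\bm{z}^c)^{\top}\bm{x}^k+\bm{d}^{\top}\bm{y}^k\big)$$ subject to $\bm{A}(\bm{z}^c)\bm{x}^c+\bm{B}\bm{y}^c\le\bm{r}(\bm{z}^c)$; $\bm{A}(\bm{z}^l)\bm{x}^c+\bm{B}\bm{y}^l\le\bm{r}(\bm{z}^l)$ and $\bm{c}(\bm{z}^l)^{\top}\bm{x}^c+\bm{d}^{\top}\bm{y}^l\le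 v(\bm{x}^k,\bm{z}^l)$ for all $\bm{z}^l\in M^k$, $l=1,\dots,|M^k|$; $\bm{z}^c\in U$. If $p_2^k\ge 0$, stop and return $\bm{x}^{\mathrm{PARO}}:=\bm{x}^k$. Otherwise let $\bm{x}^c,\bm{z}^c$ be the corresponding components of an optimal solution and solve $Q(\bm{x}^c)$. If $q(\bm{x}^c)\le\mathrm{OPT}$, set $\bm{x}^{k+1}=\bm{x}^c$ and $M^{k+1}=M^k\cup\{\bm{z}^c\}$. If $q(\bm{x}^c)>\mathrm{OPT}$, let $\bm{z}^q$ be the optimizer of $Q(\bm{x}^c)$ and set $\bm{x}^{k+1}=\bm{x}^k$ and $M^{k+1}=M^k\cup\{\bm{z}^q\}$. Then increase $k$ by one and repeat. *)

(* Defs.v *)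
From HB Require Import structures.
From mathcomp Require Import all_boot all_order all_algebra finmap.
From mathcomp Require Import all_classical all_reals all_analysis.

Set Implicit Arguments.
Unset Strict Implicit.
Unset Printing Implicit Defensive.

Import Order.TTheory GRing.Theory Num.Theory.
Import numFieldNormedType.Exports.

Local Open Scope classical_set_scope.
Local Open Scope ring_scope.

Section Geometry.
Context {R : realType}.

Definition dot n (u v : 'cV[R]_n) : R := (u^T *m v) 0 0.

Definition vle n (u v : 'cV[R]_n) : Prop := forall i, u i 0 <= v i 0.

Definition affine_fun (V W : lmodType R) (f : V -> W) : Prop :=
  exists (g : {linear V -> W}) (b : W), forall z, f z = g z + b.

Definition affine_set (V : lmodType R) (S : set V) : Prop :=
  forall u v t, S u -> S v -> S ((1 - t) *: u + t *: v).

Definition affine_hull (V : lmodType R) (S : set V) : set V :=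
  smallest (@affine_set V) S.

Definition relative_interior n (S : set 'cV[R]_n) : set 'cV[R]_n :=
  [set z | affine_hull S z /\ \forall w \near z, affine_hull S w -> S w].

(* Measurability is Borel measurability, on both sides. *)
Definition decision_rule L n (y : 'cV[R]_L -> 'cV[R]_n) : Prop :=
  measurable_fun setT
    (y : g_sigma_algebraType (@open 'cV[R]_L) ->
         g_sigma_algebraType (@open 'cV[R]_n)) /\
  forall K : set 'cV[R]_L, compact K -> [bounded y z | z in K].

End Geometry.

Record problem (R : realType) (L nx ny m : nat) := Problem {
  uset : set 'cV[R]_L ;
  matA : 'cV[R]_L -> 'M[R]_(m, nx) ;
  matB : 'M[R]_(m, ny) ;
  rhs : 'cV[R]_L -> 'cV[R]_m ;
  costc : 'cV[R]_L -> 'cV[R]_nx ;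
  costd : 'cV[R]_ny }.

Section TwoStage.
Context {R : realType} {L nx ny m : nat} (P : problem R L nx ny m).

Local Notation scenario := 'cV[R]_L.
Local Notation stage1 := 'cV[R]_nx.
Local Notation stage2 := 'cV[R]_ny.

Implicit Types (z : scenario) (x : stage1) (w : stage2) (y : scenario -> stage2).

Definition recourse x z : set stage2 :=
  [set w | vle (matA P z *m x + matB P *m w) (rhs P z)].

Definition cost x w z : R := dot (costc P z) x + dot (costd P) w.

Definition ARF x y : Prop :=
  decision_rule y /\ forall z, uset P z -> recourse x z (y z).

Definition ARF1 : set stage1 := [set x | exists y, ARF x y].

(* Every optimal value is an infimum or supremum in \bar R; attainment is asked
   for only where an optimal solution is used. *)
Definition worst_case x y : \bar R :=
  ereal_sup [set (cost x (y z) z)%:E | z in uset P].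

Definition OPT : \bar R :=
  ereal_inf [set worst_case xy.1 xy.2 | xy in [set xy | ARF xy.1 xy.2]].

Definition ARO x y : Prop :=
  ARF x y /\ forall z, uset P z -> ((cost x (y z) z)%:E <= OPT)%E.

Definition ARO1 : set stage1 := [set x | exists y, ARO x y].

Definition dominates x' y' x y : Prop :=
  (forall z, uset P z -> cost x' (y' z) z <= cost x (y z) z) /\
  (exists2 z, uset P z & cost x' (y' z) z < cost x (y z) z).

Definition PARO x y : Prop :=
  ARO x y /\ ~ exists x' y', ARO x' y' /\ dominates x' y' x y.

Definition PARO1 : set stage1 := [set x | exists y, PARO x y].

(* The infimum of an empty set is +oo, so infeasible recourse costs +oo. *)
Definition scenario_value x z : \bar R :=
  ((dot (costc P z) x)%:E +
   ereal_inf [set (dot (costd P) w)%:E | w in recourse x z])%E.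

Definition q_value x : \bar R := ereal_sup [set scenario_value x z | z in uset P].

Definition q_optimizer x : set scenario :=
  [set z | uset P z /\ scenario_value x z = q_value x].

Local Open Scope fset_scope.

Definition v_value (MARO : {fset scenario}) x z : \bar R :=
  if z \in MARO then OPT else scenario_value x z.

(* A choice of the outer variables of the second-phase problem; the copies y^l
   of the recourse are indexed by the scenarios in M themselves. *)
Record candidate (M : {fset scenario}) := Candidate {
  zc : scenario ;
  xc : stage1 ;
  yc : stage2 ;
  yl : {ffun M -> stage2} }.

Section SecondPhase.
Variables (MARO : {fset scenario}) (x : stage1) (M : {fset scenario}).

Definition p2_feasible : set (candidate M) :=
  [set s | [/\ uset P (zc s),
               recourse (xc s) (zc s) (yc s),
               (forall l : M, recourse (xc s) (val l) (yl s l))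
             & forall l : M, ((cost (xc s) (yl s l) (val l))%:E
                              <= v_value MARO x (val l))%E]].

Definition p2_objective (s : candidate M) : \bar R :=
  ereal_sup [set (cost (xc s) (yc s) (zc s) - cost x yk (zc s))%:E
            | yk in recourse x (zc s)].

Definition p2_value : \bar R := ereal_inf [set p2_objective s | s in p2_feasible].

Definition p2_optimal : set (candidate M) :=
  [set s | p2_feasible s /\ p2_objective s = p2_value].

End SecondPhase.

Inductive step (MARO : {fset scenario}) x (M : {fset scenario}) :
    stage1 -> {fset scenario} -> Prop :=
| StepAccept (s : candidate M) :
    (p2_value MARO x M < 0)%E -> p2_optimal MARO x s ->
    (q_value (xc s) <= OPT)%E ->
    step MARO x M (xc s) (M `|` [fset zc s])
| StepReject (s : candidate M) (zq : scenario) :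
    (p2_value MARO x M < 0)%E -> p2_optimal MARO x s ->
    (OPT < q_value (xc s))%E -> q_optimizer (xc s) zq ->
    step MARO x M x (M `|` [fset zq]).

Inductive iterate (xARO : stage1) (MARO : {fset scenario}) :
    nat -> stage1 -> {fset scenario} -> Prop :=
| IterateInit : iterate xARO MARO 0 xARO MARO
| IterateStep k x M x' M' :
    iterate xARO MARO k x M -> step MARO x M x' M' ->
    iterate xARO MARO k.+1 x' M'.

Definition returns (xARO : stage1) (MARO : {fset scenario}) (xPARO : stage1) :
    Prop :=
  exists k M, iterate xARO MARO k xPARO M /\ (0 <= p2_value MARO xPARO M)%E.

End TwoStage.

(* Main.v *)
Require Import Defs.
From HB Require Import structures.
From mathcomp Require Import all_boot all_order all_algebra finmap.
From mathcomp Require Import all_classical all_reals all_analysis.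
From mathcomp Require Import lra.

(* If a stage-1 decision x satisfies [scenario_value x z <= OPT] on U, choosing
   for each z a recourse optimal for x gives an ARO pair, provided the choice
   can be made measurable and bounded on compact sets.  Fourier-Motzkin
   elimination provides a continuous choice: each variable is set to the
   largest of its lower bounds (or the smallest of its upper bounds), which are
   continuous functions of the right-hand side.  If an ARO pair dominated x with
   this recourse, strictly at zbar, then together with zbar and its own
   recourses it would be feasible in the second-phase problem with negative
   objective, contradicting termination. *)

Set Implicit Arguments.
Unset Strict Implicit.
Unset Printing Implicit Defensive.

Import Order.TTheory GRing.Theory Num.Theory.
Import numFieldNormedType.Exports.

Local Open Scope classical_set_scope.
Local Open Scope ring_scope.

(** * Continuous solutions of linear inequality systems with a continuous right-hand side *)

Section ParametricLP.
Context {R : realType} {T : topologicalType}.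

Lemma continuous_addr (f g : T -> R) :
  continuous f -> continuous g -> continuous (fun t => f t + g t).
Proof. by move=> cf cg t; apply: cvgD; [exact: cf|exact: cg]. Qed.

Lemma continuous_subr (f g : T -> R) :
  continuous f -> continuous g -> continuous (fun t => f t - g t).
Proof. by move=> cf cg t; apply: cvgB; [exact: cf|exact: cg]. Qed.

Lemma continuous_combination n (u : 'I_n -> T -> R) (c : 'I_n -> R) :
  (forall k, continuous (u k)) -> continuous (fun t => \sum_k u k t * c k).
Proof.
move=> cu; apply: continuous_big => [|k _ t]; first exact: add_continuous.
by apply: cvgM; [exact: cu|exact: cvg_cst].
Qed.

Lemma continuous_maximum (I : finType) (Q : pred I) (l : I -> T -> R) (i0 : I) :
  Q i0 -> (forall i, continuous (l i)) ->
  exists2 x : T -> R, continuous x &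
    forall b, (forall i, Q i -> l i b <= x b) /\ (exists2 i, Q i & x b = l i b).
Proof.
move=> Qi0 cl.
(* The iterated maximum starts at 0; shifting by [l i0] turns that default into the term of [i0], so
   the maximum is attained. *)
exists (fun b => l i0 b + \big[Num.max/0]_(i | Q i) (l i b - l i0 b)).
  move=> b; apply: cvgD; first exact: cl.
  move: b; apply: continuous_big => [p|i _ c].
    by apply: (@continuous_max R _ fst snd); [exact: cvg_fst|exact: cvg_snd].
  by apply: cvgB; exact: cl.
move=> b; split=> [i Qi|].
  by rewrite -lerBlDl (@le_bigmax_cond _ _ _ _ _ _ (fun i => l i b - l i0 b)).
suff [i Qi ->] : exists2 i, Q i &
    \big[Num.max/0]_(i | Q i) (l i b - l i0 b) = l i b - l i0 b.
  by exists i; rewrite // subrKC.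
elim/big_ind : _ => [|_ _ [i Qi ->] [j Qj ->]|i Qi].
- by exists i0; rewrite ?subrr.
- by case: leP => _; [exists j|exists i].
- by exists i.
Qed.

Lemma continuous_minimum (I : finType) (Q : pred I) (u : I -> T -> R) (i0 : I) :
  Q i0 -> (forall i, continuous (u i)) ->
  exists2 x : T -> R, continuous x &
    forall b, (forall i, Q i -> x b <= u i b) /\ (exists2 i, Q i & x b = u i b).
Proof.
move=> Qi0 cu.
have [|x cx xP] := @continuous_maximum _ _ (fun i b => - u i b) _ Qi0.
  by move=> i b; apply: cvgN; exact: cu.
exists (fun b => - x b) => [b|b]; first by apply: cvgN; exact: cx.
have [ge [i Qi xi]] := xP b; split=> [j Qj|].
  by rewrite lerNl; exact: ge.
by exists i; rewrite // xi opprK.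
Qed.

(* After division by |c i|, the second clause says that every lower bound on
   the variable is below every upper bound. *)
Definition compatible (I : finType) (c f : I -> R) : Prop :=
  (forall i, c i = 0 -> 0 <= f i) /\
  (forall i j, 0 < c i -> c j < 0 -> - c j * f i + c i * f j >= 0).

Lemma compatible_solution (I : finType) (c f : I -> R) (x : R) :
  (forall i, c i * x <= f i) -> compatible c f.
Proof.
move=> H; split=> [i ci|i j ci cj]; first by rewrite -(mul0r x) -ci H.
have := H i; have := H j; nra.
Qed.

(** With some negative coefficient, the largest lower bound is the least solution. With none,
    solutions are closed downwards, and the smallest upper bound, or 0 if there is no upper bound,
    is chosen. *)
Lemma one_variable_selection (I : finType) (c : I -> R) (f : I -> T -> R) :
  (forall i, continuous (f i)) ->
  exists2 x : T -> R, continuous x &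
    (forall b, compatible c (f^~ b) -> forall i, c i * x b <= f i b) /\
    ((forall b x', (forall i, c i * x' <= f i b) -> x b <= x') \/
     (forall b x' x'', (forall i, c i * x' <= f i b) -> x'' <= x' ->
        forall i, c i * x'' <= f i b)).
Proof.
move=> cf.
have cg i : continuous (fun b => f i b / c i).
  by move=> b; apply: cvgM; [exact: cf|exact: cvg_cst].
have [[i0 ci0]|noneg] := pselect (exists i, c i < 0).
  have [x cx xP] := @continuous_maximum _ (fun i => c i < 0) _ _ ci0 cg.
  exists x => //; split=> [b [H0 H] i|].
    have [ge [j cj xj]] := xP b.
    have [ci|ci|ci] := ltgtP (c i) 0.
    - by rewrite mulrC -ler_ndivrMr// ge.
    (* The upper bound from row [i] is compared with the row [j] that attains the largest lower
       bound. *)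
    - rewrite xj mulrA ler_ndivrMr//.
      by have := H _ _ ci cj; nra.
    - by rewrite ci mul0r H0.
  left=> b x' H; have [_ [j cj ->]] := xP b.
  by rewrite ler_ndivrMr// mulrC.
have c_ge0 i : 0 <= c i by rewrite leNgt; apply/negP => ci; apply: noneg; exists i.
have mono b x' x'' : (forall i, c i * x' <= f i b) -> x'' <= x' ->
    forall i, c i * x'' <= f i b.
  by move=> H le i; apply: le_trans (H i); exact: ler_wpM2l.
have [[i0 ci0]|nopos] := pselect (exists i, 0 < c i).
  have [x cx xP] := @continuous_minimum _ (fun i => 0 < c i) _ _ ci0 cg.
  exists x => //; split; last by right.
  move=> b [H0 H] i; have [le _] := xP b.
  have [ci|ci] := eqVneq (c i) 0; first by rewrite ci mul0r H0.
  have {}ci : 0 < c i by rewrite lt_neqAle eq_sym ci c_ge0.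
  by rewrite mulrC -ler_pdivlMr// le.
exists (fun=> 0); first exact: cst_continuous.
split; last by right.
move=> b [H0 _] i; rewrite mulr0 H0//.
by apply/eqP; rewrite eq_le c_ge0 andbT leNgt; apply/negP => ci; apply: nopos; exists i.
Qed.

Lemma compatible_solvable (I : finType) (c f : I -> R) (b : T) :
  compatible c f -> exists x, forall i, c i * x <= f i.
Proof.
move=> cf; have [|x _ [xP _]] := @one_variable_selection I c (fun i => cst (f i)).
  by move=> i; exact: cst_continuous.
by exists (x b); exact: xP.
Qed.

(** Points are functions on [nat] of which the first [n] values count, so that a variable is dropped
    or appended without casts. *)
Definition solves n (I : finType) (a : I -> nat -> R) (g : I -> R)
  (w : nat -> R) : Prop := forall i, \sum_(k < n) a i k * w k <= g i.

(* Indexing by all pairs keeps the eliminated system over a finType; the pairs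
   that produce no constraint give the trivial row [0 <= 0]. *)
Definition fm_combine (I : finType) (c g : I -> R) (p : I * I) : R :=
  if (0 < c p.1) && (c p.2 < 0) then - c p.2 * g p.1 + c p.1 * g p.2
  else if c p.1 == 0 then g p.1 else 0.

(** [fm_combine] is linear in the combined column, hence commutes with the sum over [k]; what
    remains is compatibility of the residuals left for the eliminated variable. *)
Lemma fm_combine_solves n (I : finType) (a : I -> nat -> R) (c g : I -> R) w :
  solves n (fun p k => fm_combine c (a^~ k) p) (fm_combine c g) w <->
  compatible c (fun i => g i - \sum_(k < n) a i k * w k).
Proof.
have combineE p : \sum_(k < n) fm_combine c (a^~ k) p * w k =
    fm_combine c (fun i => \sum_(k < n) a i k * w k) p.
  rewrite /fm_combine; case: ifP => _; last case: ifP => _ //.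
    rewrite !mulr_sumr -big_split/=; apply: eq_bigr => k _.
    by rewrite mulrDl !mulrA.
  by rewrite big1// => k _; rewrite mul0r.
split=> [H|[H0 H] p]; last first.
  rewrite combineE /fm_combine; case: ifP => [/andP[c1 c2]|_].
    by have := H _ _ c1 c2; lra.
  by case: ifP => // /eqP /H0; rewrite subr_ge0.
split=> [i ci|i j ci cj].
  by have := H (i, i); rewrite combineE /fm_combine/= ci ltxx eqxx subr_ge0.
have := H (i, j); rewrite combineE /fm_combine/= ci cj /=; lra.
Qed.

(* The variable with index 0 is eliminated last, hence chosen first, as the
   largest of its lower bounds: this makes the selection optimal. *)
Lemma lp_selection n (I : finType) (a : I -> nat -> R) (f : I -> T -> R) :
  (forall i, continuous (f i)) ->
  exists2 S : nat -> T -> R, (forall k, continuous (S k)) &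
    (forall b w, solves n.+1 a (f^~ b) w -> solves n.+1 a (f^~ b) (S^~ b)) /\
    ((forall b w, solves n.+1 a (f^~ b) w -> S 0 b <= w 0%N) \/
     (forall b w r, solves n.+1 a (f^~ b) w ->
        exists2 w', solves n.+1 a (f^~ b) w' & w' 0%N <= r)).
Proof.
elim: n I a f => [|n IHn] I a f cf.
  have [x cx [xP xmin]] := one_variable_selection (fun i => a i 0%N) cf.
  exists (fun _ => x) => //; split=> [b w H i|].
    rewrite big_ord1 xP//; apply: (@compatible_solution _ _ _ (w 0%N)) => j.
    by have := H j; rewrite big_ord1.
  case: xmin => xmin; [left=> b w H|right=> b w r H].
    by apply: xmin => i; have := H i; rewrite big_ord1.
  exists (fun=> Num.min r (w 0%N)); last by rewrite ge_min lexx.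
  move=> i; rewrite big_ord1; apply: (xmin b (w 0%N)).
    by move=> j; have := H j; rewrite big_ord1.
  by rewrite ge_min lexx orbT.
pose c i := a i n.+1.
pose a' p k := fm_combine c (a^~ k) p.
pose f' p b := fm_combine c (f^~ b) p.
have cf' p : continuous (f' p).
  rewrite /f' /fm_combine; case: (_ && _); last case: (_ == _).
  - move=> b; apply: cvgD; (apply: cvgM; [exact: cvg_cst|exact: cf]).
  - exact: cf.
  - exact: cst_continuous.
have [S cS [SP Smin]] := IHn _ a' f' cf'.
have solves_compatible b (w : nat -> R) : solves n.+1 a' (f'^~ b) w <->
    compatible c (fun i => f i b - \sum_(k < n.+1) a i k * w k).
  exact: fm_combine_solves.
have solves_sub b w : solves n.+2 a (f^~ b) w -> solves n.+1 a' (f'^~ b) w.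
  move=> H; apply/solves_compatible.
  apply: (@compatible_solution _ _ _ (w n.+1)) => i.
  by rewrite lerBrDl; have := H i; rewrite big_ord_recr.
have [|x cx [xP _]] :=
    @one_variable_selection I c (fun i b => f i b - \sum_(k < n.+1) a i k * S k b).
  move=> i b; apply: cvgB; first exact: cf.
  move: b; apply: continuous_big => [|k _ b]; first exact: add_continuous.
  by apply: cvgM; [exact: cvg_cst|exact: cS].
pose extend (w : nat -> R) t (k : nat) := if k == n.+1 then t else w k.
have extendP b (w : nat -> R) t : (forall i, c i * t <= f i b - \sum_(k < n.+1) a i k * w k) ->
    solves n.+2 a (f^~ b) (extend w t).
  move=> H i; rewrite big_ord_recr/= {2}/extend eqxx -lerBrDl.
  apply: le_trans (H i) _; rewrite lerD2l lerN2 ler_sum// => k _.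
  by rewrite /extend ltn_eqF.
exists (fun k b => extend (S^~ b) (x b) k).
  by move=> k; rewrite /extend; case: eqP => _; [exact: cx|exact: cS].
split=> [b w /solves_sub H|].
  by apply: extendP; apply: xP; apply: (solves_compatible b (S^~ b)).1; exact: SP H.
(* Index 0 is untouched by [extend], so minimality passes over from the smaller system. In the other
   case [w'] needs a new last coordinate [t] of its own. *)
case: Smin => Smin; [left=> b w /solves_sub|right=> b w r /solves_sub H].
  exact: Smin.
have [w' /solves_compatible w'P w'r] := Smin b w r H.
have [t tP] := compatible_solvable b w'P.
by exists (extend w' t) => //; exact: extendP.
Qed.

End ParametricLP.

(** * Affine data, continuous decision rules and continuous selection of optimal points *)

Lemma continuous_mx {R : realType} {T : topologicalType} m n
    (f : T -> 'M[R]_(m, n)) :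
  (forall i j, continuous (fun t => f t i j)) -> continuous f.
Proof.
move=> cf t A [Q tQ sQA]; apply: (filterS sQA).
have : \forall u \near t, forall i j, Q i j (f u i j).
  by apply: filter_forall => i; apply: filter_forall => j; exact/cf/tQ.
exact.
Qed.

(** Expanding [z] in the standard basis makes each entry a linear combination of coordinates plus a
    constant. *)
Lemma affine_fun_continuous {R : realType} L m n (f : 'cV[R]_L -> 'M[R]_(m, n)) :
  affine_fun f -> forall i j, continuous (fun z => f z i j).
Proof.
move=> [g [b fE]] i j.
have -> : (fun z => f z i j) =
    (fun z => \sum_k z k 0 * g (delta_mx k 0) i j + b i j).
  apply/funext => z; rewrite fE mxE {1}(matrix_sum_delta z) linear_sum summxE.
  by congr (_ + _); apply: eq_bigr => k _; rewrite big_ord1 linearZ !mxE.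
apply: continuous_addr; last exact: cst_continuous.
by apply: continuous_combination => k; exact: coord_continuous.
Qed.

Lemma continuous_decision_rule {R : realType} L n (y : 'cV[R]_L -> 'cV[R]_n) :
  continuous y -> decision_rule y.
Proof.
move=> cy; split.
  apply: (@measurability _ _ (g_sigma_algebraType (@open 'cV[R]_L))
    (g_sigma_algebraType (@open 'cV[R]_n)) _ y open) => // _ [V oV <-].
  apply: sub_sigma_algebra; rewrite setTI.
  by move/continuousP : cy; apply.
move=> K cK; have [N [Nreal yN]] : bounded_set (y @` K).
  apply: compact_bounded; apply: continuous_compact => //.
  exact: continuous_subspaceT.
by exists N; split=> // M /yN yM z Kz; apply: yM; exists z.
Qed.

Lemma dotE {R : realType} n (u v : 'cV[R]_n) : dot u v = \sum_k u k 0 * v k 0.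
Proof. by rewrite /dot mxE; apply: eq_bigr => k _; rewrite mxE. Qed.

(** The row [None] says that variable 0 bounds [dot d] from above; a selection that minimises this
    epigraph variable minimises the objective. *)
Lemma polyhedral_selection {R : realType} {T : topologicalType} p n
    (B : 'M[R]_(p, n)) (d : 'cV[R]_n) (b : T -> 'cV[R]_p) :
  (forall i, continuous (fun t => b t i 0)) ->
  exists2 y : T -> 'cV[R]_n, continuous y &
    (forall t w, vle (B *m w) (b t) -> vle (B *m y t) (b t)) /\
    ((forall t w, vle (B *m w) (b t) -> dot d (y t) <= dot d w) \/
     (forall t w r, vle (B *m w) (b t) ->
        exists2 w', vle (B *m w') (b t) & dot d w' <= r)).
Proof.
move=> cb.
pose entry (u : 'I_n -> R) (k : nat) : R := oapp u 0 (insub k).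
have entryE u (k : 'I_n) : entry u k = u k by rewrite /entry valK.
pose a (i : option 'I_p) k : R :=
  match i, k with
  | Some i, k'.+1 => entry (B i) k'
  | Some _, 0%N => 0
  | None, k'.+1 => entry (d^~ 0) k'
  | None, 0%N => -1
  end.
pose f (i : option 'I_p) t := if i is Some i then b t i 0 else 0.
have cf i : continuous (f i) by case: i => [i|]; [exact: cb|exact: cst_continuous].
pose low (w : nat -> R) : 'cV[R]_n := \col_(k < n) w k.+1.
have solvesE t w : solves n.+1 a (f^~ t) w <->
    vle (B *m low w) (b t) /\ dot d (low w) <= w 0%N.
  have sumB i : (B *m low w) i 0 = \sum_(k < n.+1) a (Some i) k * w k.
    rewrite big_ord_recl mul0r add0r mxE; apply: eq_bigr => k _.
    by rewrite mxE lift0/= entryE.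
  have sumd : dot d (low w) - w 0%N = \sum_(k < n.+1) a None k * w k.
    rewrite big_ord_recl mulN1r addrC dotE; congr (_ + _).
    by apply: eq_bigr => k _; rewrite mxE lift0/= entryE.
  split=> [H|[H Hd] [i|]]; rewrite -?sumB -?sumd ?subr_le0//.
  by split=> [i|]; rewrite ?sumB; [exact: H (Some i)|rewrite -subr_le0 sumd; exact: H None].
pose up (w : 'cV[R]_n) k := if k is k'.+1 then entry (w^~ 0) k' else dot d w.
have upK w : low (up w) = w by apply/colP => k; rewrite mxE/= entryE.
have up_solves t w : vle (B *m w) (b t) -> solves n.+1 a (f^~ t) (up w).
  by move=> H; apply/solvesE; rewrite upK.
have [S cS [SP Smin]] := lp_selection n a cf.
exists (fun t => low (S^~ t)).
  apply: continuous_mx => k j.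
  have -> : (fun t => low (S^~ t) k j) = S k.+1 by apply/funext => t; rewrite mxE.
  exact: cS.
split=> [t w /up_solves /SP /solvesE[]//|].
case: Smin => Smin; [left=> t w|right=> t w r] => /up_solves H.
  by apply: le_trans (Smin _ _ H); have /solvesE[] := SP _ _ H.
have [w' /solvesE[w'P w'd] w'r] := Smin _ _ r H.
by exists (low w') => //; exact: le_trans w'r.
Qed.

(** * Optimal recourse rules and adaptive robust optimality *)

Section Termination.
Context {R : realType} {L nx ny m : nat} (P : problem R L nx ny m).
Hypothesis A_affine : affine_fun (matA P).
Hypothesis r_affine : affine_fun (rhs P).
Hypothesis c_affine : affine_fun (costc P).
Hypothesis OPT_finite : OPT P \is a fin_num.

Definition slack x z : 'cV[R]_m := rhs P z - matA P z *m x.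

Lemma slack_continuous x i : continuous (fun z => slack x z i 0).
Proof.
have -> : (fun z => slack x z i 0) =
    (fun z => rhs P z i 0 - \sum_k matA P z i k * x k 0).
  by apply/funext => z; rewrite !mxE.
apply: continuous_subr; first exact: affine_fun_continuous.
by apply: continuous_combination => k; exact: affine_fun_continuous.
Qed.

Lemma recourse_slack x z w : recourse P x z w <-> vle (matB P *m w) (slack x z).
Proof. by split=> H i; have := H i; rewrite !mxE; lra. Qed.

Lemma stage1_cost_continuous x : continuous (fun z => dot (costc P z) x).
Proof.
have -> : (fun z => dot (costc P z) x) = (fun z => \sum_k costc P z k 0 * x k 0).
  by apply/funext => z; rewrite dotE.
by apply: continuous_combination => k; exact: affine_fun_continuous.
Qed.

(* If some recourse were unbounded below, adding the constraint [cost <= r] to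
   the system would give adaptive robustly feasible pairs of worst-case cost at
   most [r], for every [r]. *)
Lemma optimal_recourse x : (forall z, uset P z -> recourse P x z !=set0) ->
  exists2 y, decision_rule y & forall z, uset P z ->
    recourse P x z (y z) /\
    forall w, recourse P x z w -> dot (costd P) (y z) <= dot (costd P) w.
Proof.
move=> feas.
have [y cy [yP]] := polyhedral_selection (matB P) (costd P) (@slack_continuous x).
case=> [ymin|unbounded].
  exists y; first exact: continuous_decision_rule.
  move=> z /feas[w /recourse_slack wP]; split.
    by apply/recourse_slack; exact: yP wP.
  by move=> w' /recourse_slack; exact: ymin.
(* A level strictly below the optimum; the last row of [B'] and [b'] imposes cost at most [r], so a
   continuous rule solving this system on [U] contradicts the definition of [OPT]. *)
pose r := fine (OPT P) - 1.
pose B' := col_mx (matB P) (costd P)^T.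
pose b' z := col_mx (slack x z) (const_mx (r - dot (costc P z) x) : 'cV_1).
have b'E z w : vle (B' *m w) (b' z) <->
    recourse P x z w /\ cost P x w z <= r.
  rewrite /B' /b' mul_col_mx recourse_slack /cost -lerBrDl; split=> [H|[H Hc] i].
    split=> [i|]; first by move: (H (lshift 1 i)); rewrite !col_mxEu.
    by have := H (rshift m 0); rewrite !col_mxEd [leRHS]mxE.
  case: (split_ordP i) => j ->; first by rewrite !col_mxEu.
  by rewrite !col_mxEd [leRHS]mxE (ord1 j).
have cb' i : continuous (fun z => b' z i 0).
  case: (split_ordP i) => j ->.
    rewrite (_ : (fun _ => _) = (fun z => slack x z j 0)).
      exact: slack_continuous.
    by apply/funext => z; rewrite col_mxEu.
  rewrite (_ : (fun _ => _) = (fun z => r - dot (costc P z) x)).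
    by apply: continuous_subr; [exact: cst_continuous|exact: stage1_cost_continuous].
  by apply/funext => z; rewrite col_mxEd mxE.
have [y' cy' [y'P _]] := polyhedral_selection B' (costd P) cb'.
have {}y'P z : uset P z -> recourse P x z (y' z) /\ cost P x (y' z) z <= r.
  move=> /feas[w /recourse_slack/(unbounded _ _ (r - dot (costc P z) x))].
  move=> [w' w'P w'r]; apply/b'E; apply: (y'P _ w'); apply/b'E.
  by rewrite recourse_slack /cost -lerBrDl.
have : (OPT P <= r%:E)%E.
  apply: (@le_trans _ _ (worst_case P x y')).
    apply: ereal_inf_lbound; exists (x, y') => //; split.
      exact: continuous_decision_rule.
    by move=> z /y'P[].
  by apply: ge_ereal_sup => _ [z /y'P[_ le] <-]; rewrite lee_fin.
by rewrite -(fineK OPT_finite) lee_fin /r; lra.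
Qed.

Lemma scenario_value_le x z w :
  recourse P x z w -> (scenario_value P x z <= (cost P x w z)%:E)%E.
Proof.
move=> wP; rewrite EFinD leeD2l//.
by apply: ereal_inf_lbound; exists w.
Qed.

Lemma scenario_value_optimal x z w : recourse P x z w ->
  (forall w', recourse P x z w' -> dot (costd P) w <= dot (costd P) w') ->
  scenario_value P x z = (cost P x w z)%:E.
Proof.
move=> wP wmin; apply/eqP; rewrite eq_le scenario_value_le//=.
rewrite EFinD leeD2l//; apply: le_ereal_inf_tmp => _ [w' w'P <-].
by rewrite lee_fin wmin.
Qed.

Lemma scenario_value_infeasible x z :
  (scenario_value P x z < +oo)%E -> recourse P x z !=set0.
Proof.
apply: contraPP => /set0P/negP/negPn/eqP r0.
by rewrite /scenario_value r0 image_set0 ereal_inf0 addey// ltxx.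
Qed.

(** The bound is finite, so every recourse set over [U] is nonempty and one rule attains all
    scenario values at once. *)
Lemma ARO1_optimal_rule x :
  (forall z, uset P z -> (scenario_value P x z <= OPT P)%E) ->
  exists2 y, ARO P x y &
    forall z, uset P z -> scenario_value P x z = (cost P x (y z) z)%:E.
Proof.
move=> le_OPT; have [z Uz|y dy yP] := @optimal_recourse x.
  apply: scenario_value_infeasible; apply: le_lt_trans (le_OPT _ Uz) _.
  by rewrite -(fineK OPT_finite) ltry.
have valE z : uset P z -> scenario_value P x z = (cost P x (y z) z)%:E.
  by move=> /yP[wP wmin]; exact: scenario_value_optimal.
exists y => //; split; first by split=> // z /yP[].
by move=> z Uz; rewrite -valE// le_OPT.
Qed.

(** Replaces the search for a decision rule by a pointwise bound, which is what the test of
    [q_value] against [OPT] checks. *)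
Lemma ARO1P x :
  ARO1 P x <-> forall z, uset P z -> (scenario_value P x z <= OPT P)%E.
Proof.
split=> [[y [[dy yP] yOPT] z Uz]|/ARO1_optimal_rule[y yARO _]]; last by exists y.
exact: le_trans (scenario_value_le (yP _ Uz)) (yOPT _ Uz).
Qed.

(** * Invariant of the procedure and Pareto optimality at termination *)

Lemma iterate_invariant xARO MARO k x M :
  ARO1 P xARO -> (forall z, z \in MARO -> uset P z) ->
  iterate P xARO MARO k x M -> ARO1 P x /\ (forall z, z \in M -> uset P z).
Proof.
move=> xARO_ARO MARO_U; elim=> // {}k {}x {}M x' M' _ [xP MU].
case=> [s _ [[Uzc _ _ _] _] q_le|s zq _ _ _ [Uzq _]]; split=> //.
- apply/ARO1P => z Uz; apply: le_trans q_le.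
  by apply: ereal_sup_ubound; exists z.
- by move=> z /fsetUP[/MU//|/fset1P->].
- by move=> z /fsetUP[/MU//|/fset1P->].
Qed.

(* A pair dominating [x] with its optimal recourse, strictly at [zbar], is
   feasible in the second-phase problem with [zc = zbar], and its objective is
   the negative gap at [zbar]. *)
Lemma p2_value_ge0_PARO (MARO M : {fset 'cV[R]_L}) x :
  ARO1 P x -> (forall z, z \in M -> uset P z) ->
  (0 <= p2_value P MARO x M)%E -> PARO1 P x.
Proof.
move=> /ARO1P/ARO1_optimal_rule[y yARO valE] MU p2_ge0; exists y; split=> //.
move=> [x' [y' [[[_ y'P] y'OPT] [dom [zbar Uzbar lt]]]]].
(* All recourse copies are read off the one dominating rule [y']. *)
pose s := @Candidate R L nx ny M zbar x' (y' zbar) [ffun l => y' (val l)].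
have s_feas : p2_feasible P MARO x s.
  split=> //=; first exact: y'P.
    by move=> l; rewrite ffunE; apply/y'P/MU/valP.
  (* On [MARO] the bound is [OPT], met because the dominating pair is ARO; elsewhere it is the cost
     of [y], and domination applies. *)
  move=> l; rewrite ffunE /v_value; case: ifP => _; first exact/y'OPT/MU/valP.
  by rewrite valE ?lee_fin; [apply: dom|]; exact/MU/valP.
have s_neg : (p2_objective P x s <=
    (cost P x' (y' zbar) zbar - cost P x (y zbar) zbar)%:E)%E.
  (* Since [y zbar] is an optimal recourse for [x] at [zbar], no other [w] makes the inner maximum
     exceed the gap. *)
  apply: ge_ereal_sup => _ [w wP <-]; rewrite lee_fin lerD2l lerN2 -lee_fin.
  by rewrite -valE// scenario_value_le.
have : (0 <= (cost P x' (y' zbar) zbar - cost P x (y zbar) zbar)%:E)%E.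
  apply: le_trans p2_ge0 _; apply: le_trans s_neg.
  by apply: ereal_inf_lbound; exists s.
by rewrite lee_fin leNgt subr_lt0 lt.
Qed.

End Termination.

Theorem lemma7 (R : realType) (L nx ny m : nat) (P : problem R L nx ny m)
    (U_compact : compact (uset P))
    (U_convex : convex_set (uset P : set (convex_lmodType 'cV[R]_L)))
    (U_relint : relative_interior (uset P) !=set0)
    (A_affine : affine_fun (matA P))
    (r_affine : affine_fun (rhs P))
    (c_affine : affine_fun (costc P))
    (X_nonempty : ARF1 P !=set0)
    (OPT_finite : OPT P \is a fin_num)
    (xARO : 'cV[R]_nx) (MARO : {fset 'cV[R]_L})
    (xARO_ARO : ARO1 P xARO)
    (MARO_U : forall z, z \in MARO -> uset P z)
    (xPARO : 'cV[R]_nx)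
    (terminates : returns P xARO MARO xPARO) :
  PARO1 P xPARO.
Proof.
have [k [M [it p2_ge0]]] := terminates.
have [xPARO_ARO MU] :=
  iterate_invariant A_affine r_affine c_affine OPT_finite xARO_ARO MARO_U it.
exact: p2_value_ge0_PARO p2_ge0.
Qed.
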